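(* A minimal iterator $\mathbf{I}$ is regular if and only if it is $\mathbb{N}$-like, i.e., if and only if it is a Peano iterator. Thus an iterator $\mathbf{I} = (X,f,x_0)$ is a Peano iterator if and only if the induced mapping $\omega_{/\approx} : \mathsf{Fin}_{/\approx} \to X$ is a bijection.
   Context: A set $E$ is finite if $\mathcal{P}(E)$ is the only subset $\mathcal{S}$ of the power set $\mathcal{P}(E)$ such that $\varnothing \in \mathcal{S}$ and $F \cup \{e\} \in \mathcal{S}$ whenever $F \in \mathcal{S}$, $F \neq E$ and $e \in E \setminus F$ (this is equivalent to the usual notion of finiteness). $\mathsf{Fin}$ denotes the (proper) class of all finite sets; $A \approx B$ means there exists a bijective mapping $A \to B$. An iterator is a triple $\mathbf{I} = (X,f,x_0)$ with $X$ a class (a set or a proper class), $f : X \to X$ a mapping and $x_0$ an element of $X$. The assignment of finite sets in $\mathbf{I}$ is the unique mapping $\omega : \mathsf{Fin} \to X$ with $\omega(\varnothing) = x_0$ and $\omega(A \cup \{a\}) = f(\omega(A))$ for each finite set $A$ and each element $a \notin A$; it satisfies $\omega(A) = \omega(B)$ whenever $A \approx B$. $\mathsf{Fin}_{/\approx}$ is the class of equivalence classes of $\approx$ on $\mathsf{Fin}$ and $\omega_{/\approx} : \mathsf{Fin}_{/\approx} \to X$ is the mapping induced by $\omega$. A subclass $Y$ of $X$ is $f$-invariant if $f(y) \in Y$ for all $y \in Y$. $\mathbf{I}$ is minimal if the only $f$-invariant subclass of $X$ containing $x_0$ is $X$ itself; $\mathbf{I}$ is regular if $B_1 \approx B_2$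 whenever $B_1, B_2$ are finite sets with $\omega(B_1) = \omega(B_2)$; $\mathbf{I}$ is $\mathbb{N}$-like if $f$ is injective and $x_0 \notin f(X)$; $\mathbf{I}$ is a Peano iterator if it is minimal and $\mathbb{N}$-like. *)

(* Defs.v *)
From HB Require Import structures.
From mathcomp Require Import all_boot.
From mathcomp Require Import mathcomp_extra boolp classical_sets functions.
From mathcomp Require Import cardinality.

Set Implicit Arguments.
Unset Strict Implicit.
Unset Printing Implicit Defensive.

Local Open Scope classical_set_scope.
Local Open Scope card_scope.
Local Open Scope quotient_scope.

Definition inductive_system (T : Type) (E : set T) (S : set (set T)) : Prop :=
  S set0 /\
  forall (F : set T) (e : T), S F -> F <> E -> (E `\` F) e -> S (F `|` [set e]).

Definition finite (T : Type) (E : set T) : Prop :=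
  forall S : set (set T),
    S `<=` [set F | F `<=` E] -> inductive_system E S -> S = [set F | F `<=` E].

Lemma finiteE (T : Type) (E : set T) : finite E <-> finite_set E.
Proof.
split=> [finE|finE].
  have finSE : [set F | F `<=` E /\ finite_set F] = [set F | F `<=` E].
    apply: finE => [F []//|]; split=> [|F e [FE finF] _ [Ee _]].
      by split=> //; exact: sub0set.
    split; first by move=> x [/FE//|->].
    by rewrite finite_setU.
  by have : [set F | F `<=` E] E by []; rewrite -finSE => -[].
move=> S SE [S0 SU]; apply/seteqP; split=> // F FE.
have [n] := sub_finite_set FE finE.
elim: n F FE => [|n IHn] F FE.
  by rewrite II0 card_eq0 => /eqP ->.
move=> /eq_cardSP[x Fx FDx].
rewrite -(setD1K Fx) setUC; apply: SU.
- by apply: IHn FDx => y [/FE].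
- by move=> FxE; have := FE _ Fx; rewrite -FxE => -[_]; apply.
- by split; [exact: FE | move=> [_]; apply].
Qed.

(* A proper class: Fin lives in a larger universe than the carriers it ranges
   over. Each type has its own copy of the empty set; these copies are
   equipotent, and an assignment sends all of them to the base point. *)
Record Fin : Type := MkFin {
  fin_carrier : Type;
  fin_set : set fin_carrier;
  fin_finite : finite fin_set }.
Arguments fin_set : clear implicits.
Arguments fin_finite : clear implicits.

Lemma finite0 (T : Type) : finite (@set0 T).
Proof. exact/finiteE. Qed.

Lemma finiteU1 (T : Type) (A : set T) (a : T) :
  finite A -> finite (A `|` [set a]).
Proof. by move=> /finiteE finA; apply/finiteE; rewrite finite_setU. Qed.

Definition fin0 (T : Type) : Fin := MkFin (@finite0 T).

Definition finU1 (A : Fin) (a : fin_carrier A) : Fin :=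
  MkFin (@finiteU1 _ _ a (fin_finite A)).

Definition approx (A B : Fin) : bool := fin_set A #= fin_set B.

Lemma approx_refl : reflexive approx.
Proof. by move=> A; exact: card_eqxx. Qed.

Lemma approx_sym : symmetric approx.
Proof. by move=> A B; exact: card_eq_sym. Qed.

Lemma approx_trans : transitive approx.
Proof. by move=> B A C; exact: card_eq_trans. Qed.

HB.instance Definition _ := gen_eqMixin Fin.
HB.instance Definition _ := gen_choiceMixin Fin.

Canonical approx_equiv := EquivRel approx approx_refl approx_sym approx_trans.

Definition Fin_mod : Type := {eq_quot approx}.

Record iterator : Type := Iterator {
  it_class : Type;
  it_map : it_class -> it_class;
  it_base : it_class }.

Definition is_assignment (I : iterator) (w : Fin -> it_class I) : Prop :=
  (forall T : Type, w (fin0 T) = it_base I) /\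
  (forall (A : Fin) (a : fin_carrier A),
     ~ fin_set A a -> w (finU1 a) = it_map (w A)).

Lemma assignment_approx (I : iterator) (w : Fin -> it_class I) :
  is_assignment w ->
  forall (A : Fin) (n : nat), fin_set A #= `I_n ->
    w A = iter n (@it_map I) (it_base I).
Proof.
move=> [w0 wS] [T A finA] n; elim: n A finA => [|n IHn] A finA /=.
  rewrite II0 card_eq0 => /eqP A0; rewrite {A}A0 in finA *.
  by rewrite (Prop_irrelevance finA (@finite0 T)) -/(fin0 T) w0.
move=> /eq_cardSP[x Ax ADx].
have finD : finite (A `\ x).
  by apply/finiteE; apply: finite_setD; exact/finiteE.
rewrite -(IHn _ finD ADx) -(wS (MkFin finD) x) ; last by move=> [_]; apply.
rewrite /finU1 /=; move: (@finiteU1 _ _ _ _) => /=.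
by rewrite setUC (setD1K Ax) => finA'; rewrite (Prop_irrelevance finA finA').
Qed.

Lemma assignment_exists (I : iterator) :
  exists w : Fin -> it_class I, is_assignment w.
Proof.
have cardP (A : Fin) : {n : nat | fin_set A #= `I_n}.
  by apply: cid; apply/finiteE; exact: fin_finite.
exists (fun A => iter (sval (cardP A)) (@it_map I) (it_base I)); split=> [T|A a nAa].
  case: (cardP _) => n /= /card_esym; rewrite card_eq0 => /eqP n0.
  by case: n n0 => //= n n0; have : `I_n.+1 0 by []; rewrite n0.
case: (cardP (finU1 a)) => n /= An; case: (cardP A) => m /= Am.
suff -> : n = m.+1 by [].
apply/card_eq_II; apply: card_eq_trans (card_esym An) _.
apply/eq_cardSP; exists a; first by right.
suff -> : (fin_set A `|` [set a]) `\ a = fin_set A by [].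
apply/seteqP; split=> y; first by move=> [[]].
by move=> Ay; split; [left | move=> ya; apply: nAa; rewrite -ya].
Qed.

Lemma assignment_unique (I : iterator) (w1 w2 : Fin -> it_class I) :
  is_assignment w1 -> is_assignment w2 -> w1 = w2.
Proof.
move=> w1P w2P; apply/funext => A.
have [n An] := (finiteE _).1 (fin_finite A).
by rewrite (assignment_approx w1P An) (assignment_approx w2P An).
Qed.

Definition omega (I : iterator) : Fin -> it_class I :=
  sval (cid (assignment_exists I)).
Arguments omega : clear implicits.

Lemma omegaP (I : iterator) : is_assignment (omega I).
Proof. exact: svalP (cid (assignment_exists I)). Qed.

Lemma omega_approx (I : iterator) (A B : Fin) :
  approx A B -> omega I A = omega I B.
Proof.
move=> AB; have [n Bn] := (finiteE _).1 (fin_finite B).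
rewrite (assignment_approx (omegaP I) Bn).
by apply: assignment_approx (omegaP I) _ _ _; exact: card_eq_trans AB Bn.
Qed.

(* By omega_modE below, the choice of representatives is immaterial. *)
Definition omega_mod (I : iterator) : Fin_mod -> it_class I :=
  fun c => omega I (repr c).
Arguments omega_mod : clear implicits.

Lemma omega_modE (I : iterator) (A : Fin) :
  omega_mod I (\pi_({eq_quot approx}) A) = omega I A.
Proof. by apply: omega_approx; apply/eqmodP; rewrite reprK. Qed.

Definition invariant_subclass (I : iterator) (Y : set (it_class I)) : Prop :=
  forall y, Y y -> Y (it_map y).

Definition minimal (I : iterator) : Prop :=
  forall Y : set (it_class I),
    invariant_subclass Y -> Y (it_base I) -> Y = setT.

Definition regular (I : iterator) : Prop :=
  forall B1 B2 : Fin, omega I B1 = omega I B2 -> approx B1 B2.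

Definition N_like (I : iterator) : Prop :=
  injective (@it_map I) /\ ~ range (@it_map I) (it_base I).

Definition Peano (I : iterator) : Prop := minimal I /\ N_like I.

(* Main.v *)
Require Import Defs.
From mathcomp Require Import all_boot.
From mathcomp Require Import boolp classical_sets cardinality.

Set Implicit Arguments.
Unset Strict Implicit.
Unset Printing Implicit Defensive.

Local Open Scope classical_set_scope.
Local Open Scope card_scope.
Local Open Scope quotient_scope.

(** Everything is read off the orbit [x0, f x0, f (f x0), ...] of the base
    point. A finite set with [n] elements is sent by [omega] to the [n]-th point
    of this orbit, and every [n] is the size of some finite set; so, up to
    equipotence, [omega] is the enumeration [orbit] of the orbit.

    Hence regularity says that [orbit] is injective ([regularP]), and minimality
    that [orbit] is surjective ([minimalP]), since the orbit is the least
    invariant subclass containing [x0]. If the iterator is N-like, two equal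
    points of the orbit can be traced back step by step, so [orbit] is injective
    ([N_like_orbit_inj]). Conversely, if [orbit] is bijective, it carries the
    successor map of the natural numbers to [f] and [0] to [x0], so that [f]
    inherits injectivity, and the avoidance of the base point, from the
    successor ([orbit_inj_N_like]).

    For the second claim, the induced map on equipotence classes is injective
    exactly when the iterator is regular ([omega_mod_injP]) and surjective
    exactly when it is minimal ([omega_mod_surjP]). *)

Definition orbit (I : iterator) (n : nat) : it_class I :=
  iter n (@it_map I) (it_base I).
Arguments orbit : clear implicits.

Lemma omega_card (I : iterator) (A : Fin) (n : nat) :
  fin_set A #= `I_n -> omega I A = orbit I n.
Proof. exact: assignment_approx (omegaP I) _ _. Qed.

Lemma fin_cardP (A : Fin) : exists n, fin_set A #= `I_n.
Proof. exact: (finiteE _).1 (fin_finite A). Qed.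

Lemma finite_II_fin (n : nat) : finite `I_n.
Proof. exact/finiteE/finite_II. Qed.

Definition initial_segment (n : nat) : Fin := MkFin (@finite_II_fin n).

Lemma omega_segment (I : iterator) (n : nat) :
  omega I (initial_segment n) = orbit I n.
Proof. by apply: omega_card; exact: card_eqxx. Qed.

Lemma omega_mod_segment (I : iterator) (n : nat) :
  omega_mod I (\pi_({eq_quot approx}) (initial_segment n)) = orbit I n.
Proof. by rewrite omega_modE omega_segment. Qed.

(** Finite sets up to equipotence are natural numbers, so comparing finite sets
    through [omega] amounts to comparing numbers through [orbit]. *)
Lemma regularP (I : iterator) : regular I <-> injective (orbit I).
Proof.
split=> [regI m n|injI A B].
  by rewrite -!omega_segment => /regI mn; exact/card_eq_II.
have [m Am] := fin_cardP A; have [n Bn] := fin_cardP B.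
rewrite (omega_card _ Am) (omega_card _ Bn) => /injI mn; rewrite -mn in Bn.
by apply: card_eq_trans Am _; rewrite card_eq_sym.
Qed.

(** The orbit of the base point is the least invariant subclass containing it. *)
Lemma minimalP (I : iterator) :
  minimal I <-> forall x, exists n, orbit I n = x.
Proof.
split=> [minI x|surjI Y invY Y0].
  suff orbitT : [set y | exists n, orbit I n = y] = setT.
    by have : setT x by []; rewrite -orbitT.
  by apply: minI => [_ [n <-]|]; [exists n.+1 | exists 0].
apply/seteqP; split=> // x _; have [n <-] := surjI x.
by elim: n => //= n; exact: invY.
Qed.

(** If two orbit points agree, injectivity of the map lets both indices descend
    together until one of them is zero; then so is the other, because the base
    point is not a value of the map. *)
Lemma N_like_orbit_inj (I : iterator) : N_like I -> injective (orbit I).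
Proof.
move=> [injf nbase]; elim=> [|m IHm] [|n] //= fmn.
- by case: nbase; exists (orbit I n).
- by case: nbase; exists (orbit I m).
- by congr _.+1; apply/IHm/injf.
Qed.

(** When the orbit is everything, the map is the successor on indices. *)
Lemma orbit_inj_N_like (I : iterator) :
  minimal I -> injective (orbit I) -> N_like I.
Proof.
move=> /minimalP surjI injI; split=> [x y|[x _]].
  have [m <-] := surjI x; have [n <-] := surjI y => fmn.
  by have /injI [->] : orbit I m.+1 = orbit I n.+1.
have [n <-] := surjI x => fn.
by have /injI : orbit I n.+1 = orbit I 0.
Qed.

Lemma minimal_regularP (I : iterator) :
  minimal I -> (regular I <-> N_like I).
Proof.
move=> minI; split=> [/regularP|/N_like_orbit_inj injI]; last exact/regularP.
exact: orbit_inj_N_like.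
Qed.

Lemma omega_mod_injP (I : iterator) : injective (omega_mod I) <-> regular I.
Proof.
split=> [injI A B AB|regI c d].
  by apply/eqmodP; apply: injI; rewrite !omega_modE.
by move=> /regI cd; rewrite -[c]reprK -[d]reprK; exact/eqmodP.
Qed.

Lemma omega_mod_surjP (I : iterator) :
  (forall x, exists c, omega_mod I c = x) <-> minimal I.
Proof.
split=> [surjI|/minimalP surjI x].
  apply/minimalP => x; have [c <-] := surjI x.
  by have [n cn] := fin_cardP (repr c); exists n; rewrite -(omega_card _ cn).
have [n <-] := surjI x.
exists (\pi_({eq_quot approx}) (initial_segment n)).
exact: omega_mod_segment.
Qed.

Lemma bijective_inj_surj (A B : Type) (h : A -> B) :
  bijective h <-> injective h /\ forall y, exists x, h x = y.
Proof.
split=> [[g hK gK]|[injh surjh]].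
  by split=> [|y]; [exact: can_inj hK | exists (g y)].
have [g gK] := choice surjh.
by exists g => // x; apply: injh; rewrite gK.
Qed.

Theorem theorem7p2 :
  (forall I : iterator, minimal I ->
     (regular I <-> N_like I) /\ (regular I <-> Peano I)) /\
  (forall I : iterator, Peano I <-> bijective (omega_mod I)).
Proof.
split=> [I minI|I].
  have regN := minimal_regularP minI.
  by split=> //; split=> [/regN|[_ /regN]].
rewrite bijective_inj_surj omega_mod_injP omega_mod_surjP.
by split=> -[]; [move=> minI | move=> + minI]; rewrite (minimal_regularP minI).
Qed.
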